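(* Let $d\ge 1$ and let $g\in\mathbb{C}^d$ be a unit vector. The rank of the Gram matrix $G(g)$ equals the number of nonzero entries in the multiset $\{\langle g, M^kT^\ell g\rangle\}_{(k,\ell)\in\mathbb{Z}_d\times\mathbb{Z}_d}$. Consequently, the Gabor POVM generated by $g$ is informationally complete if and only if $\langle g,M^kT^\ell g\rangle\neq 0$ for all $k,\ell\in\mathbb{Z}_d$.
   Context: Vectors in $\mathbb{C}^d$ are indexed by $\mathbb{Z}_d=\mathbb{Z}/d\mathbb{Z}=\{0,\dots,d-1\}$, $\omega=e^{2\pi i/d}$, and $\langle x,y\rangle=\sum_n x_n\overline{y_n}$. The modulation and translation operators on $\mathbb{C}^d$ are $(Mg)_n=\omega^n g_n$ and $(Tg)_n=g_{n-1}$ (indices mod $d$). For $(k,\ell)\in\mathbb{Z}_d\times\mathbb{Z}_d$ let $g_{k,\ell}=M^kT^\ell g$ and $\Pi_{k,\ell}=g_{k,\ell}g_{k,\ell}^*$, a $d\times d$ matrix. With $\langle A,B\rangle_{HS}=\mathrm{tr}(AB^* )$, the Gram matrix is the $d^2\times d^2$ matrix $G(g)=(\langle \Pi_{k,\ell},\Pi_{k',\ell'}\rangle_{HS})_{(k,\ell),(k',\ell')}$. The Gabor POVM generated by $g$ is informationally complete if the $d^2$ matrices $\Pi_{k,\ell}$ form a basis of the space of complex $d\times d$ matrices. *)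

(* Defs.v *)
(* The complex numbers are R[i] for an arbitrary R : realType. *)
From HB Require Import structures.
From mathcomp Require Import all_boot all_order all_algebra.
From mathcomp Require Import reals trigo.
From mathcomp.real_closed Require Import complex.
Set Implicit Arguments.
Unset Strict Implicit.
Unset Printing Implicit Defensive.
Import Order.TTheory GRing.Theory Num.Theory.
Local Open Scope ring_scope.
Local Open Scope sesquilinear_scope.

(* e^{2 pi i / d} *)
Definition omega (R : realType) (d : nat) : R[i] :=
  Complex (cos (2 * pi / d%:R)) (sin (2 * pi / d%:R)).

(* Z_d is represented by 'I_d, whose cyclic predecessor ord_pred is n - 1 mod d. *)

Definition inner (R : realType) (d : nat) (x y : 'cV[R[i]]_d) : R[i] :=
  \sum_(n < d) x n 0 * Num.conj (y n 0).

Definition modulation (R : realType) (d : nat) (g : 'cV[R[i]]_d) :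
    'cV[R[i]]_d :=
  \col_(n < d) (omega R d ^+ n * g n 0).

Definition translation (R : realType) (d : nat) (g : 'cV[R[i]]_d) :
    'cV[R[i]]_d :=
  \col_(n < d) g (ord_pred n) 0.

(* M^k T^l g; the exponents are the representatives of k, l in {0, .., d-1},
   which is harmless because M^d and T^d are the identity. *)
Definition gabor (R : realType) (d : nat) (g : 'cV[R[i]]_d) (k l : 'I_d) :
    'cV[R[i]]_d :=
  iter k (@modulation R d) (iter l (@translation R d) g).

Definition gabor_proj (R : realType) (d : nat) (g : 'cV[R[i]]_d)
    (p : 'I_d * 'I_d) : 'M[R[i]]_d :=
  gabor g p.1 p.2 *m (gabor g p.1 p.2)^t*.

Definition innerHS (R : realType) (d : nat) (A B : 'M[R[i]]_d) : R[i] :=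
  \tr (A *m B^t*).

(* Rows and columns are indexed by Z_d x Z_d through its enumeration;
   the size of the matrix is #|{: 'I_d * 'I_d}| = d ^ 2. *)
Definition gram (R : realType) (d : nat) (g : 'cV[R[i]]_d) :
    'M[R[i]]_(#|{: 'I_d * 'I_d}|) :=
  \matrix_(i, j) innerHS (gabor_proj g (enum_val i)) (gabor_proj g (enum_val j)).

(* The sequence lists the whole family, so a repeated matrix makes it non-free. *)
Definition informationally_complete (R : realType) (d : nat)
    (g : 'cV[R[i]]_d) : Prop :=
  basis_of {: 'M[R[i]]_d} [seq gabor_proj g p | p : 'I_d * 'I_d].

(* Main.v *)
Require Import Defs.
From HB Require Import structures.
From mathcomp Require Import all_boot all_order all_algebra.
From mathcomp Require Import reals trigo.
From mathcomp.real_closed Require Import complex.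
From mathcomp Require Import ring lra zify.
Set Implicit Arguments.
Unset Strict Implicit.
Unset Printing Implicit Defensive.
Import Order.TTheory GRing.Theory Num.Theory.
Local Open Scope ring_scope.
Local Open Scope sesquilinear_scope.

(** The Weyl operators M^a T^b form an orthogonal basis of the d x d matrices,
    and they are eigenvectors of conjugation by M^k T^l, because Weyl operators
    commute up to a root of unity.  Hence the Weyl coefficients of Pi_(k,l) are those of
    Pi_(0,0) = g g^* up to phases,
      tr(Pi_(k,l) (M^a T^b)^* ) = omega^(k b - l a) <g, M^a T^b g>.
    In matrix form: let V have as rows the flattened Pi_(k,l), W the flattened
    M^a T^b, let Phi be the symplectic Fourier matrix omega^(k b - l a), and let
    D be the diagonal matrix of the numbers <g, M^a T^b g>.  Then
      V W^* = Phi D            (lemma [projector_weyl]),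
      W W^* = d,  Phi Phi^* = d^2   (lemmas [weyl_orthogonal] and
                                     [fourier_orthogonal]).
    Both halves of the theorem follow.  The Gram matrix is V V^*, and W^* W = d,
    so d G = (V W^* )(V W^* )^* = Phi (D D^* ) Phi^* with Phi invertible: the
    rank of G is the number of nonzero entries of D.  The Pi_(k,l) are d^2
    matrices in a space of dimension d^2, so they form a basis iff V is
    invertible, iff D is, iff no entry of D vanishes.

    The bicharacter omega^(a b) of Z_d is called [chi]; all orthogonality
    relations reduce to the vanishing of sums of its nontrivial characters. *)

(** * The root of unity omega *)

Lemma omega_expr (R : realType) d j : omega R d ^+ j =
  Complex (cos (2 * pi / d%:R *+ j)) (sin (2 * pi / d%:R *+ j)).
Proof.
elim: j => [|j IH]; first by rewrite expr0 !mulr0n cos0 sin0.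
by rewrite exprS IH /omega !mulrS cosD sinD; congr Complex; ring.
Qed.

Lemma omega_expr_order (R : realType) d : (0 < d)%N -> omega R d ^+ d = 1.
Proof.
move=> d0; have dn0 : d%:R != 0 :> R by rewrite pnatr_eq0 -lt0n.
rewrite omega_expr -mulr_natr divfK// mulr_natl cos2pi.
by rewrite mulr2n sinD sinpi mul0r mulr0 addr0.
Qed.

Lemma omega_conjM (R : realType) d : omega R d * Num.conj (omega R d) = 1.
Proof.
have -> : Num.conj (omega R d) =
  Complex (cos (2 * pi / d%:R)) (- sin (2 * pi / d%:R)) by [].
rewrite /omega; have := cos2Dsin2 (2 * pi / d%:R : R).
set c := cos _; set s := sin _ => E.
have -> : Complex c s * Complex c (- s) =
  Complex (c * c - s * - s) (c * - s + s * c) by [].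
by rewrite mulrN opprK -!expr2 E mulrN mulrC addNr.
Qed.

(** If cos (2 x) = 1 then sin x = 0, which fails for x = pi j / d in ]0, pi[. *)
Lemma omega_expr_neq1 (R : realType) d j :
  (0 < j < d)%N -> omega R d ^+ j != 1.
Proof.
case/andP=> j0 jd; apply/eqP; rewrite omega_expr => -[C _].
have d0 : 0 < d%:R :> R by rewrite ltr0n (leq_trans _ jd).
pose x : R := pi * j%:R / d%:R.
have xE : 2 * pi / d%:R *+ j = x *+ 2 :> R.
  by rewrite -mulr_natl -[RHS]mulr_natl /x; ring.
have s0 : 0 < sin x.
  apply: sin_gt0_pi; rewrite /x divr_gt0 ?mulr_gt0 ?pi_gt0 ?ltr0n//=.
    by rewrite ltr_pdivrMr// ltr_pM2l ?pi_gt0// ltr_nat.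
  exact: leq_trans jd.
move: C; rewrite xE cos_mulr2n => C.
have s20 : 0 < sin x ^+ 2 by rewrite exprn_gt0.
by have := cos2Dsin2 x; lra.
Qed.

(** * Matrices: rank, freeness, indexing by a finite type *)

Section Matrices.
Variable F : fieldType.

(** The row space of a diagonal matrix is the direct sum of the coordinate
    lines at its nonzero entries. *)
Lemma mxrank_diag n (v : 'rV[F]_n) :
  \rank (diag_mx v) = #|[set i | v 0 i != 0]|.
Proof.
have E : (diag_mx v :=:
    \sum_(i | v 0 i != 0) <<delta_mx 0 i : 'rV[F]_n>>)%MS.
  apply/eqmxP/andP; split.
    apply/row_subP => i; rewrite row_diag_mx.
    have [->|vi] := eqVneq (v 0 i) 0; first by rewrite scale0r sub0mx.
    by rewrite scalemx_sub// (sumsmx_sup i)// genmxE.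
  apply/sumsmx_subP => i vi; rewrite genmxE.
  rewrite -[delta_mx 0 i]scale1r -(mulVf vi) -scalerA -row_diag_mx.
  by rewrite scalemx_sub// row_sub.
rewrite E (mxdirectP _)/=; last by apply: mxdirect_delta => i j _ _.
under eq_bigr do rewrite genmxE mxrank_delta.
by rewrite sum1dep_card.
Qed.

Lemma mulmx_scalar_unit n (A B : 'M[F]_n) c : c != 0 -> A *m B = c%:M ->
  (A \in unitmx) /\ (B \in unitmx).
Proof.
move=> c0 E; apply/andP; rewrite -unitmx_mul E unitmxE det_scalar unitfE.
by rewrite expf_neq0.
Qed.

Lemma free_flatten (I : finType) m n (X : I -> 'M[F]_(m, n))
    (A : 'M[F]_(#|I|, #|{: 'I_m * 'I_n}|)) :
  (forall i j, A i j = X (enum_val i) (enum_val j).1 (enum_val j).2) ->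
  free [seq X p | p : I] = row_free A.
Proof.
move=> AE; have sX : size [seq X p | p : I] == #|I| by rewrite size_image.
have comb (c : 'rV_#|I|) : (c *m A == 0) =
    (\sum_(i < #|I|) c 0 i *: [seq X p | p : I]`_i == 0).
  have E j : (c *m A) 0 j =
      (\sum_(i < #|I|) c 0 i *: [seq X p | p : I]`_i)
        (enum_val j).1 (enum_val j).2.
    rewrite mxE summxE; apply: eq_bigr => i _.
    by rewrite !mxE AE nth_image.
  apply/eqP/eqP => [c0|c0].
    apply/matrixP => a b; have := E (enum_rank (a, b)).
    by rewrite c0 enum_rankK !mxE.
  by apply/rowP => j; rewrite E c0 !mxE.
apply/(@freeP _ _ _ (Tuple sX))/idP => [fr|fr c c0].
  rewrite -kermx_eq0; apply/eqP/row_matrixP => i; rewrite row0.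
  apply/rowP => j; rewrite [RHS]mxE; apply: fr j; apply/eqP.
  by rewrite -comb -row_mul mulmx_ker row0.
move=> i; have/eqP : \row_j c j *m A == 0.
  rewrite comb; apply/eqP; rewrite -[RHS]c0.
  by apply: eq_bigr => j _; rewrite mxE.
by rewrite -[RHS](mul0mx _ A) => /(row_free_inj fr)/rowP/(_ i); rewrite !mxE.
Qed.

End Matrices.

Section FintypeMatrices.
Variables (C : numClosedFieldType) (T : finType).

(** Flattened d x d matrices and their families are both indexed by pairs, so
    all the matrices of the proof can be square over one finite type; entries
    are then computed on T rather than on ordinals. *)
Definition fintype_mx (f : T -> T -> C) : 'M[C]_#|{: T}| :=
  \matrix_(i, j) f (enum_val i) (enum_val j).

Lemma eq_fintype_mx (f h : T -> T -> C) :
  (forall p q, f p q = h p q) -> fintype_mx f = fintype_mx h.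
Proof. by move=> E; apply/matrixP => i j; rewrite !mxE E. Qed.

Lemma fintype_mx_mulC f h : fintype_mx f *m (fintype_mx h)^t* =
  fintype_mx (fun p q => \sum_r f p r * Num.conj (h q r)).
Proof.
apply/matrixP => i j; rewrite !mxE [RHS]big_enum_val /=.
by apply: eq_bigr => r _; rewrite !mxE.
Qed.

Lemma fintype_mx_scalar c : fintype_mx (fun p q => c *+ (p == q)) = c%:M.
Proof. by apply/matrixP => i j; rewrite !mxE (inj_eq enum_val_inj). Qed.

Lemma trmxC_mul m n p (A : 'M[C]_(m, n)) (B : 'M[C]_(n, p)) :
  (A *m B)^t* = B^t* *m A^t*.
Proof. by rewrite trmx_mul map_mxM. Qed.

End FintypeMatrices.

(** * The bicharacter of Z_d and the Gabor system *)

(** For d = D + 1, the type 'I_d carries the addition of Z_d. *)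
Section Gabor.
Variables (R : realType) (D : nat).
Notation d := D.+1.
Notation C := R[i].
Notation T := ('I_d * 'I_d)%type.

Definition chi (a b : 'I_d) : C := omega R d ^+ (a * b).

Lemma chiC a b : chi a b = chi b a.
Proof. by rewrite /chi mulnC. Qed.

Lemma chiDl a b c : chi (a + b) c = chi a c * chi b c.
Proof.
have o1 : omega R d ^+ d = 1 by rewrite omega_expr_order.
by rewrite /chi -exprD -mulnDl exprM /= (expr_mod _ o1) -exprM.
Qed.

Lemma chiDr a b c : chi a (b + c) = chi a b * chi a c.
Proof. by rewrite chiC chiDl chiC (chiC c). Qed.

Lemma chi0l a : chi 0 a = 1.
Proof. by rewrite /chi mul0n expr0. Qed.

Lemma chi_neq0 a b : chi a b != 0.
Proof.
have : chi a b * chi (- a) b != 0 by rewrite -chiDl subrr chi0l oner_eq0.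
by rewrite mulf_eq0 negb_or => /andP[].
Qed.

Lemma chiNl a b : chi (- a) b = (chi a b)^-1.
Proof.
by apply: (mulfI (chi_neq0 a b)); rewrite -chiDl subrr chi0l mulfV ?chi_neq0.
Qed.

Lemma chiNr a b : chi a (- b) = (chi a b)^-1.
Proof. by rewrite chiC chiNl chiC. Qed.

Lemma conj_chi a b : Num.conj (chi a b) = (chi a b)^-1.
Proof.
apply: (mulfI (chi_neq0 a b)); rewrite mulfV ?chi_neq0//.
by rewrite /chi rmorphXn -exprMn omega_conjM expr1n.
Qed.

(** For a != 0 the sum is geometric, with ratio omega^a != 1 and
    (omega^a)^d = 1. *)
Lemma chi_sum a : \sum_m chi a m = d%:R *+ (a == 0).
Proof.
have [->|a0] := eqVneq a 0.
  by under eq_bigr do rewrite chi0l; rewrite sumr_const card_ord.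
have w1 : omega R d ^+ a != 1.
  by rewrite omega_expr_neq1// ltn_ord lt0n andbT.
rewrite -subr_eq0 in w1; apply: (mulfI w1); rewrite mulr0.
under eq_bigr do rewrite /chi exprM.
by rewrite -subrX1 -exprM mulnC exprM omega_expr_order// expr1n subrr.
Qed.

Lemma iter_ord_pred l (n : 'I_d) : (l <= d)%N ->
  iter l (@ord_pred d) n = ((n + (d - l)) %% d)%N :> nat.
Proof.
elim: l => [|l IH] ld; first by rewrite subn0 modnDr modn_small.
rewrite iterS /= IH; last exact: ltnW.
have -> : (d - l = (d - l.+1).+1)%N by lia.
set x := (n + (d - l.+1))%N.
have -> : (((n + (d - l.+1).+1) %% d + d).-1 = x.+1 %% d + D)%N.
  by rewrite /x !addnS.
by rewrite modnDml addSnnS modnDr.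
Qed.

Lemma iter_ord_predE (l n : 'I_d) : iter l (@ord_pred d) n = n - l.
Proof.
have E : n - l = ((n + (d - l) %% d) %% d)%N :> nat by [].
apply: ord_inj; rewrite E modnDmr iter_ord_pred; last exact: ltnW (ltn_ord l).
by [].
Qed.

Lemma gaborE (g : 'cV[C]_d) k l n : gabor g k l n 0 = chi k n * g (n - l) 0.
Proof.
have tE (h : 'cV[C]_d) j m :
    iter j (@translation R d) h m 0 = h (iter j (@ord_pred d) m) 0.
  by elim: j m => //= j IH m; rewrite mxE IH -iterSr.
have mE (h : 'cV[C]_d) j m :
    iter j (@modulation R d) h m 0 = omega R d ^+ (j * m) * h m 0.
  elim: j => [|j IH] /=; first by rewrite mul0n mul1r.
  by rewrite mxE IH mulrA -exprD.
by rewrite /gabor mE tE iter_ord_predE.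
Qed.

(** * Weyl operators and the symplectic Fourier matrix *)

(** The (q.1, q.2) entry of the Weyl operator M^p.1 T^p.2. *)
Definition weyl (p q : T) : C := chi p.1 q.1 *+ (q.2 == q.1 - p.2).

Definition fourier (p q : T) : C := chi p.1 q.2 * Num.conj (chi p.2 q.1).

Lemma sum_pair (F : T -> C) : \sum_r F r = \sum_m \sum_n F (m, n).
Proof. by rewrite pair_bigA; apply: eq_bigr => -[]. Qed.

(** Weyl operators have one nonzero entry per row, so a Hilbert-Schmidt product
    with one of them is a single sum. *)
Lemma sum_weyl (F : T -> C) q :
  \sum_r F r * Num.conj (weyl q r) =
  \sum_m F (m, m - q.2) * Num.conj (chi q.1 m).
Proof.
rewrite sum_pair; apply: eq_bigr => m _.
rewrite (bigD1 (m - q.2))//= /weyl/= eqxx mulr1n big1 ?addr0// => n /negPf ->.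
by rewrite mulr0n rmorph0 mulr0.
Qed.

Lemma weyl_orthogonal : fintype_mx weyl *m (fintype_mx weyl)^t* = d%:R%:M.
Proof.
rewrite fintype_mx_mulC -fintype_mx_scalar; apply: eq_fintype_mx => -[a b] [a' b'].
rewrite sum_weyl /weyl/= xpair_eqE.
under eq_bigr do
  rewrite (inj_eq (addrI _)) eqr_opp mulrnAl conj_chi -chiNl -chiDl.
by rewrite sumrMnl chi_sum -mulrnA mulnb subr_eq0 [b' == b]eq_sym.
Qed.

Lemma fourier_orthogonal :
  fintype_mx fourier *m (fintype_mx fourier)^t* = (d%:R * d%:R)%:M.
Proof.
rewrite fintype_mx_mulC -fintype_mx_scalar; apply: eq_fintype_mx => -[k l] [k' l'].
rewrite sum_pair xpair_eqE /fourier/=.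
transitivity ((\sum_b chi (l' - l) b) * \sum_a chi (k - k') a).
  rewrite big_distrlr/=; apply: eq_bigr => a _; apply: eq_bigr => b _.
  rewrite !rmorphM/= !conj_chi fmorphV/= !conj_chi !chiDl !chiNl.
  by field; rewrite !chi_neq0.
rewrite !chi_sum !subr_eq0 eq_sym.
by case: (k == k'); case: (l == l'); rewrite ?mulr0n ?mulr1n ?mulr0 ?mul0r.
Qed.

(** * The Gram matrix and informational completeness *)

Variable g : 'cV[C]_d.

Definition projector (p q : T) : C := gabor_proj g p q.1 q.2.

Let dnz : d%:R != 0 :> C. Proof. by rewrite pnatr_eq0. Qed.
Let W := fintype_mx weyl.
Let Phi := fintype_mx fourier.
Let V := fintype_mx projector.
Let v : 'rV[C]_#|{: T}| :=
  \row_j inner g (gabor g (enum_val j).1 (enum_val j).2).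

Lemma projectorE p q : projector p q =
  gabor g p.1 p.2 q.1 0 * Num.conj (gabor g p.1 p.2 q.2 0).
Proof. by rewrite /projector /gabor_proj mxE big_ord1 !mxE. Qed.

(** The covariance identity
    tr(Pi_(k,l) (M^a T^b)^* ) = omega^(k b - l a) <g, M^a T^b g>. *)
Lemma projector_weyl : V *m W^t* = Phi *m diag_mx v.
Proof.
rewrite fintype_mx_mulC mul_mx_diag; apply/matrixP => i j; rewrite !mxE.
move: (enum_val i) (enum_val j) => [k l] [a b]; rewrite sum_weyl/=.
(* the shift m := m + l undoes the translation T^l *)
rewrite /inner mulr_sumr (reindex_inj (addIr l))/=.
apply: eq_bigr => m _; rewrite projectorE/= !gaborE.
rewrite /fourier/= !rmorphM/= !conj_chi addrK addrAC addrK.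
rewrite !chiDr chiNr (chiC l a).
by field; rewrite !chi_neq0.
Qed.

Lemma gramE : gram g = V *m V^t*.
Proof.
rewrite fintype_mx_mulC; apply/matrixP => i j; rewrite !mxE /innerHS sum_pair.
apply: eq_bigr => m _; rewrite mxE; apply: eq_bigr => n _.
by rewrite /projector; congr (_ * _); rewrite !mxE.
Qed.

(** W is a multiple of a unitary matrix, so inserting W^* W between V and V^*
    only scales the Gram matrix. *)
Lemma gram_diag : d%:R *: gram g =
  Phi *m diag_mx (\row_j (v 0 j * Num.conj (v 0 j))) *m Phi^t*.
Proof.
have WW : (W)^t* *m W = d%:R%:M.
  have Winv : W *m (d%:R^-1 *: W^t*) = 1%:M.
    by rewrite -scalemxAr weyl_orthogonal scale_scalar_mx mulVf.
  move/mulmx1C: Winv; rewrite -scalemxAl => /(congr1 ( *:%R d%:R)).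
  by rewrite scalerA mulfV// scale1r scalemx1.
have E : (V *m W^t*) *m (V *m W^t*)^t* = d%:R *: gram g.
  rewrite gramE trmxC_mul -mulmxA (mulmxA (W^t*)).
  have -> : (W^t*)^t* = W by apply/matrixP => i j; rewrite !mxE conjCK.
  by rewrite WW mul_scalar_mx -scalemxAr.
rewrite -E projector_weyl trmxC_mul -!mulmxA; congr (_ *m _).
rewrite !mulmxA; congr (_ *m _).
apply/matrixP => i j; rewrite mul_diag_mx !mxE.
by have [->|_] := eqVneq i j; rewrite ?mulr1n // ?mulr0n ?rmorph0 ?mulr0.
Qed.

Lemma fourier_unit : (Phi \in unitmx) /\ (Phi^t* \in unitmx).
Proof. by apply: mulmx_scalar_unit fourier_orthogonal; rewrite mulf_neq0. Qed.

Lemma gram_rank :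
  \rank (gram g) = #|[set p : T | inner g (gabor g p.1 p.2) != 0]|.
Proof.
have [P1 P2] := fourier_unit.
rewrite -(eqmx_scale _ dnz) gram_diag mxrankMfree ?row_free_unit//.
rewrite (eqmxMfull _ _) ?row_full_unit// mxrank_diag.
rewrite -(card_imset _ (@enum_val_inj _ _)); congr #|pred_of_set _|.
apply/setP => p; rewrite inE; apply/imsetP/idP => [[j]|p0].
  by rewrite inE !mxE mulf_eq0 conjC_eq0 orbb => ? ->.
exists (enum_rank p); rewrite ?enum_rankK//.
by rewrite inE !mxE mulf_eq0 conjC_eq0 orbb enum_rankK.
Qed.

Lemma informationally_complete_unitmx :
  informationally_complete g <-> V \in unitmx.
Proof.
have dimE : (\dim {: 'M[C]_d} <= #|{: T}|)%N.
  by rewrite dimvf dim_matrix card_prod card_ord.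
rewrite /informationally_complete basisEfree subvf size_image dimE !andbT.
rewrite (free_flatten (A := V)) ?row_free_unit//.
by move=> i j; rewrite mxE.
Qed.

Lemma projector_unitmx :
  (V \in unitmx) = [forall p : T, inner g (gabor g p.1 p.2) != 0].
Proof.
have [P1 _] := fourier_unit.
have [_ W2] := mulmx_scalar_unit dnz weyl_orthogonal.
have := congr1 (fun A => A \in unitmx) projector_weyl.
rewrite !unitmx_mul P1 W2 andbT /= => ->.
rewrite unitmxE det_diag unitfE; apply/prodf_neq0/forallP => H p.
  by have := H (enum_rank p) isT; rewrite mxE enum_rankK.
by rewrite mxE.
Qed.

End Gabor.

Theorem theorem1 (R : realType) (d : nat) (hd : (1 <= d)%N)
    (g : 'cV[R[i]]_d) (hg : inner g g = 1) :
  \rank (gram g) = #|[set p : 'I_d * 'I_d | inner g (gabor g p.1 p.2) != 0]|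
  /\ (informationally_complete g <->
      forall k l : 'I_d, inner g (gabor g k l) <> 0).
Proof.
case: d hd g {hg} => // D _ g; split; first exact: gram_rank.
rewrite informationally_complete_unitmx projector_unitmx.
split=> [/forallP nz k l | nz]; first exact/eqP/(nz (k, l)).
by apply/forallP => -[k l]; apply/eqP.
Qed.
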